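(* There are infinitely many elliptic curves of the form $$E_t:\ y^2=x^3-(2t)^2x+(t^2-1)^2,\qquad t\in\mathbb{Q},$$ with rank $\geq 3$; that is, there are infinitely many $t\in\mathbb{Q}$ for which $E_t$ is an elliptic curve over $\mathbb{Q}$ of rank at least $3$.
   Context: The rank of an elliptic curve $E$ over $\mathbb{Q}$ is the nonnegative integer $r$ such that $E(\mathbb{Q})\cong\mathbb{Z}^r\times E(\mathbb{Q})_{\mathrm{tors}}$. *)

(* Defs.v *)
From HB Require Import structures.
From mathcomp Require Import all_boot all_order all_algebra.
From mathcomp Require Import ring.
From mathcomp Require Import boolp classical_sets functions cardinality.

Set Implicit Arguments.
Unset Strict Implicit.
Unset Printing Implicit Defensive.

Import Order.TTheory GRing.Theory Num.Theory.
Local Open Scope ring_scope.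

(* The curve y^2 = x^3 + a x + b. *)
Record weierstrass := Weierstrass { coef_a : rat; coef_b : rat }.

Definition discriminant (E : weierstrass) : rat :=
  - 16 * (4 * coef_a E ^+ 3 + 27 * coef_b E ^+ 2).

Definition elliptic (E : weierstrass) : bool := discriminant E != 0.

Inductive point := Infinity | Affine of rat & rat.

Definition on_curve (E : weierstrass) (p : point) : bool :=
  match p with
  | Infinity => true
  | Affine x y => y ^+ 2 == x ^+ 3 + coef_a E * x + coef_b E
  end.

Definition third_point (l x1 y1 x2 : rat) : point :=
  let x3 := l ^+ 2 - x1 - x2 in Affine x3 (l * (x1 - x3) - y1).

(* Chord-tangent law.  On the curve, x1 = x2 and y1 <> - y2 force
   y1 = y2 <> 0, so the tangent slope has a nonzero denominator. *)
Definition padd (E : weierstrass) (p q : point) : point :=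
  match p, q with
  | Infinity, _ => q
  | _, Infinity => p
  | Affine x1 y1, Affine x2 y2 =>
      if x1 == x2 then
        if y1 == - y2 then Infinity
        else third_point ((3 * x1 ^+ 2 + coef_a E) / (2 * y1)) x1 y1 x2
      else third_point ((y2 - y1) / (x2 - x1)) x1 y1 x2
  end.

Lemma padd_on_curve E p q :
  on_curve E p -> on_curve E q -> on_curve E (padd E p q).
Proof.
case: p q => [|x1 y1] [|x2 y2] //= /eqP e1 /eqP e2.
have Eb : coef_b E = y1 ^+ 2 - x1 ^+ 3 - coef_a E * x1 by rewrite e1; ring.
case: (eqVneq x1 x2) => [ex|nx].
  subst x2; case: (eqVneq y1 (- y2)) => [//|ny] /=.
  have : (y1 - y2) * (y1 + y2) = 0 by rewrite -subr_sqr e1 e2 subrr.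
  move/eqP; rewrite mulf_eq0 subr_eq0 addr_eq0 (negbTE ny) orbF => /eqP ey.
  have y0 : y1 != 0.
    apply: contra_neq ny => y10; rewrite -ey y10 oppr0 //.
  by apply/eqP; rewrite Eb; field.
have d : x2 - x1 != 0 by rewrite subr_eq0 eq_sym.
have Ea : coef_a E = (y2 ^+ 2 - y1 ^+ 2) / (x2 - x1)
                     - (x2 ^+ 2 + x1 * x2 + x1 ^+ 2).
  by rewrite e1 e2; field.
by apply/eqP; rewrite Eb Ea; field.
Qed.

Definition rational_points (E : weierstrass) := {p : point | on_curve E p}.

Definition ezero (E : weierstrass) : rational_points E :=
  exist (fun p => on_curve E p) Infinity isT.

Definition eadd (E : weierstrass) (P Q : rational_points E) :
    rational_points E :=
  exist (fun p => on_curve E p) _ (padd_on_curve (proj2_sig P) (proj2_sig Q)).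

Definition torsion_points (E : weierstrass) : set (rational_points E) :=
  [set P | exists2 n : nat, (0 < n)%N & iter n (eadd P) (ezero E) = ezero E].

(* E(Q) is isomorphic to Z^r x E(Q)_tors; the target is the subset
   Z^r x E(Q)_tors of Z^r x E(Q), with componentwise addition. *)
Definition has_rank (E : weierstrass) (r : nat) : Prop :=
  exists f : rational_points E -> 'rV[int]_r * rational_points E,
    set_bij [set: rational_points E]
      ([set: 'rV[int]_r] `*` @torsion_points E)%classic f /\
    forall P Q,
      f (eadd P Q) = ((f P).1 + (f Q).1, eadd (f P).2 (f Q).2).

Definition embeds_Zn (E : weierstrass) (n : nat) : Prop :=
  exists g : 'rV[int]_n -> rational_points E,
    injective g /\ forall u v, g (u + v) = eadd (g u) (g v).

(* The integer r with [has_rank E r] is at least n.  That such an r exists is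
   the Mordell-Weil theorem, which is not part of this assertion; the second
   conjunct, a consequence of the first given Mordell-Weil, keeps the assertion
   from being vacuous without it. *)
Definition rank_ge (E : weierstrass) (n : nat) : Prop :=
  (forall r, has_rank E r -> (n <= r)%N) /\ embeds_Zn E n.

Definition curve_E (t : rat) : weierstrass :=
  Weierstrass (- (2 * t) ^+ 2) ((t ^+ 2 - 1) ^+ 2).

(* Main.v *)
Require Import Defs.
From HB Require Import structures.
From mathcomp Require Import all_boot all_order all_algebra.
From mathcomp Require Import ring lra zify.
From mathcomp Require Import boolp classical_sets functions cardinality.

Set Implicit Arguments.
Unset Strict Implicit.
Unset Printing Implicit Defensive.

Import Order.TTheory GRing.Theory Num.Theory.
Local Open Scope ring_scope.

(** Write [a = 2 t], [b = t^2 - 1], [c = t^2 + 1], so that [a^2 + b^2 = c^2] and the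
    curve is [y^2 = x^3 - a^2 x + b^2]. It contains [(0, b)] and [(a, b)], and if
    moreover [t^2 + 2 = s^2] it contains [(c, b s)]. The rational points of this
    conic are [t = (2 - m^2) / (2 m)], [s = (2 + m^2) / (2 m)], and for all natural
    numbers [m] in a certain residue class modulo [7 * 11 * 17] the three points
    are independent.

    A relation between the three points can be halved when its coefficients are
    even and there is no rational point of order two. Independence
    ([independent_of_mod2]) therefore follows from two facts: the cubic has no
    rational root, and none of the seven nonempty sums of the three points is of
    the form [2 Q]. Both are established by reduction modulo primes. A rational
    root would reduce to a root modulo [11] ([no_root_of_reduction]). If [2 Q] has
    an abscissa without pole at [p], then the duplication formula reduces to an
    equation over [F_p] in the coordinates of a point of the reduced curve
    ([not_double_of_reduction]), which exhaustive search excludes for six of the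
    sums when [p = 17], and for the seventh when [p = 7]. Since only the
    duplication formula is reduced, no group law over [F_p] is involved. The
    tests depend only on [m] modulo [7], [11] and [17], whence infinitely many [t].

    To compute in [E(Q)] one needs that the chord-tangent law is a group law. The
    only difficult axiom is associativity ([paddA]). It becomes short when a line
    is described by a slope that satisfies two polynomial equations, valid for
    chords and tangents alike: if [l] and [m] are the slopes from [Q] to [P] and
    from [Q] to [R], the slopes of the last additions in [(P + Q) + R] and
    [P + (Q + R)] are [k - l] and [k - m] with a common [k] ([line_slope_add]).

    Finally a copy of [Z^3] in [E(Q)] forces every isomorphism of [E(Q)] with
    [Z^r x E(Q)_tors] to have [r >= 3] ([embeds_Zn_rank_ge]). *)

(** * The group law *)

Definition popp (P : Defs.point) : Defs.point :=
  if P is Affine x y then Affine x (- y) else Infinity.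

(** For two points of the curve that are not opposite, exactly one [l] satisfies
    both equations: by the curve equation they agree where both determine [l],
    the first one gives the chord when the abscissas differ, and the second one
    gives the tangent when the points coincide. Chords and tangents are thereby
    treated together, by polynomial identities. *)
Definition line_slope (A l x1 y1 x2 y2 : rat) : Prop :=
  y2 - y1 = l * (x2 - x1) /\ l * (y1 + y2) = x1 ^+ 2 + x1 * x2 + x2 ^+ 2 + A.

Lemma popp_on_curve E P : on_curve E P -> on_curve E (popp P).
Proof. by case: P => //= x y; rewrite sqrrN. Qed.

Lemma paddC E P Q : on_curve E P -> on_curve E Q -> padd E P Q = padd E Q P.
Proof.
case: P Q => [|x1 y1] [|x2 y2] //= /eqP e1 /eqP e2.
rewrite (eq_sym x2); case: (eqVneq x1 x2) => [ex|nx]; last first.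
  have d : x2 - x1 != 0 by rewrite subr_eq0 eq_sym.
  have d' : x1 - x2 != 0 by rewrite subr_eq0.
  by rewrite /third_point; congr Affine; field; rewrite d d'.
subst x2; rewrite (eq_sym y2) eqr_oppLR; case: eqVneq => // ny.
have : (y1 - y2) * (y1 + y2) = 0 by rewrite -subr_sqr e1 e2 subrr.
move/eqP; rewrite mulf_eq0 subr_eq0 addr_eq0 (negbTE ny) orbF.
by move=> /eqP ->.
Qed.

(** The tangent at a point of order two is vertical: at a singular point the
    group law fails, and this is where the discriminant excludes it. *)
Lemma elliptic_smooth E x y : elliptic E -> on_curve E (Affine x y) ->
  y = 0 -> 3 * x ^+ 2 + coef_a E != 0.
Proof.
move=> ell /eqP e y0; apply: contraNneq ell => /eqP; rewrite addrC addr_eq0.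
move=> /eqP eA; rewrite /discriminant.
have eB : coef_b E = 2 * x ^+ 3.
  have -> : coef_b E = y ^+ 2 - x ^+ 3 - coef_a E * x by rewrite e; ring.
  by rewrite y0 eA; ring.
by apply/eqP; rewrite eA eB; ring.
Qed.

Lemma line_slope_exists E x1 y1 x2 y2 :
    on_curve E (Affine x1 y1) -> on_curve E (Affine x2 y2) ->
    Affine x2 y2 <> popp (Affine x1 y1) ->
  exists l, line_slope (coef_a E) l x1 y1 x2 y2.
Proof.
move=> /= /eqP e1 /eqP e2 nopp.
case: (eqVneq x1 x2) => [ex|nx].
  subst x2; have : (y1 - y2) * (y1 + y2) = 0 by rewrite -subr_sqr e1 e2 subrr.
  move/eqP; rewrite mulf_eq0 subr_eq0 addr_eq0 => /orP[/eqP ey|/eqP ey].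
    subst y2; have y0 : y1 != 0.
      by apply/eqP => y0; apply: nopp; rewrite y0 oppr0.
    exists ((3 * x1 ^+ 2 + coef_a E) / (2 * y1)).
    by split; field.
  by case: nopp; rewrite ey opprK.
have d : x2 - x1 != 0 by rewrite subr_eq0 eq_sym.
exists ((y2 - y1) / (x2 - x1)); split; first by field.
have -> : (y2 - y1) / (x2 - x1) * (y1 + y2) = (y2 ^+ 2 - y1 ^+ 2) / (x2 - x1).
  by field.
by rewrite e1 e2; field.
Qed.

(** Two opposite points have no slope on a smooth curve, so a slope alone
    determines the sum. *)
Lemma padd_line_slope E l x1 y1 x2 y2 : elliptic E ->
    on_curve E (Affine x1 y1) -> on_curve E (Affine x2 y2) ->
    line_slope (coef_a E) l x1 y1 x2 y2 ->
  padd E (Affine x1 y1) (Affine x2 y2) = third_point l x1 y1 x2.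
Proof.
move=> ell c1 c2 [s1 s2] /=; case: (eqVneq x1 x2) => [ex|nx].
  subst x2; have ey : y2 = y1.
    by apply/eqP; rewrite -subr_eq0 s1 subrr mulr0.
  subst y2; rewrite -addr_eq0; case: (eqVneq (y1 + y1) 0) => y0.
    have y10 : y1 = 0 by apply/eqP; move/eqP: y0; rewrite -mulr2n mulrn_eq0.
    case/eqP: (elliptic_smooth ell c1 y10).
    by move: s2; rewrite y0 mulr0 => ->; ring.
  congr third_point; have -> : 2 * y1 = y1 + y1 by ring.
  by apply: (mulIf y0); rewrite s2 divfK //; ring.
have d : x2 - x1 != 0 by rewrite subr_eq0 eq_sym.
by congr third_point; rewrite s1 mulfK.
Qed.

(** The reflection in the x-axis of the line through [P], [Q] and the opposite
    of [P + Q] has slope [- l]; it joins [- P] to [P + Q] and meets the curve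
    again in [Q]. *)
Lemma paddNK E P Q : elliptic E -> on_curve E P -> on_curve E Q ->
  padd E (popp P) (padd E P Q) = Q.
Proof.
move=> ell cP cQ; case: (pselect (Q = popp P)) => [->|].
  by case: P cP => //= x y _; rewrite eqxx opprK eqxx.
case: P cP => // x1 y1 cP; case: Q cQ => [|x2 y2] cQ nopp.
  by rewrite /= !eqxx.
have [l sl] := line_slope_exists cP cQ nopp.
have := padd_on_curve cP cQ; rewrite (padd_line_slope ell cP cQ sl).
rewrite {1 2}/third_point => cS.
case: sl => s1 s2; have ey : y2 = y1 + l * (x2 - x1) by rewrite -s1; ring.
have eA : coef_a E = l * (y1 + y2) - (x1 ^+ 2 + x1 * x2 + x2 ^+ 2).
  by rewrite s2; ring.
rewrite (@padd_line_slope E (- l) _ _ _ _ ell (popp_on_curve cP) cS).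
  by rewrite /third_point ey; congr Affine; ring.
by split; rewrite ?eA ?ey; ring.
Qed.

Lemma line_slope_sym A l x1 y1 x2 y2 :
  line_slope A l x1 y1 x2 y2 -> line_slope A l x2 y2 x1 y1.
Proof.
move=> [s1 s2]; split; last by rewrite addrC s2; ring.
by rewrite -opprB s1; ring.
Qed.

(** Each of the two lines through the middle point expresses [A] as a polynomial
    in its slope and the coordinates; eliminating [A] leaves an equation that is
    linear in [y2]. Hence [x1], [x2], [x3], [l] and [m] are free parameters of
    the whole configuration. *)
Lemma line_slope_common_ordinate A l m x1 y1 x2 y2 x3 y3 : l != m ->
    line_slope A l x1 y1 x2 y2 -> line_slope A m x2 y2 x3 y3 ->
  y2 = ((x1 - x3) * (x1 + x2 + x3) - l ^+ 2 * (x1 - x2)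
        + m ^+ 2 * (x3 - x2)) / (2 * (l - m)).
Proof.
move=> nlm [s1 s2] [s3 s4].
have d : 2 * (l - m) != 0 by rewrite mulf_neq0 ?subr_eq0.
have e1 : y1 = y2 + l * (x1 - x2) by rewrite -[LHS](subKr y2) s1; ring.
have e3 : y3 = y2 + m * (x3 - x2) by rewrite -s3; ring.
have : l * (y1 + y2) - (x1 ^+ 2 + x1 * x2 + x2 ^+ 2) =
       m * (y2 + y3) - (x2 ^+ 2 + x2 * x3 + x3 ^+ 2) by rewrite s2 s4; ring.
by rewrite e1 e3 => h; apply: (mulIf d); rewrite divfK //; lra.
Qed.

(** The key to associativity. In the free parameters the slope from [P + Q] to
    [R] is [k - l], where [k = (x1 - x3) / (l - m)], and by symmetry the slope
    from [P] to [Q + R] is [k - m]. The formula for [k - l] comes from the chord,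
    but it satisfies both slope equations identically, and therefore also
    covers the case [P + Q = R], in which the line is a tangent. *)
Lemma line_slope_add A l m x1 y1 x2 y2 x3 y3 : l != m ->
    line_slope A l x1 y1 x2 y2 -> line_slope A m x2 y2 x3 y3 ->
    let x4 := l ^+ 2 - x1 - x2 in
  line_slope A ((x1 - x3) / (l - m) - l) x4 (l * (x1 - x4) - y1) x3 y3.
Proof.
move=> nlm sl sm x4; have d : l - m != 0 by rewrite subr_eq0.
have e2 := line_slope_common_ordinate nlm sl sm.
case: sl sm => [s1 s2] [s3 s4].
have e1 : y1 = y2 + l * (x1 - x2) by rewrite -[LHS](subKr y2) s1; ring.
have e3 : y3 = y2 + m * (x3 - x2) by rewrite -s3; ring.
have eA : A = m * (y2 + y3) - (x2 ^+ 2 + x2 * x3 + x3 ^+ 2) by rewrite s4; ring.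
by split; rewrite ?eA ?e1 ?e3 /x4 e2; field.
Qed.

(** When [P + Q] or [Q + R] vanishes, this is cancellation. Otherwise let [l] and
    [m] be the slopes from [Q] to [P] and to [R]. If [l = m], the three points
    are on one line, and either [P = R] or [P + Q + R = 0]. If [l] and [m]
    differ, the slopes [k - l] and [k - m] of the last additions are known and
    give the same point. *)
Lemma paddA E P Q R : elliptic E ->
    on_curve E P -> on_curve E Q -> on_curve E R ->
  padd E P (padd E Q R) = padd E (padd E P Q) R.
Proof.
move=> ell cP cQ cR.
case: (pselect (Q = popp P)) => [eQ|nPQ].
  have eP : P = popp Q by rewrite eQ; case: {+}P => //= x y; rewrite opprK.
  rewrite {1}eP paddNK // eQ (_ : padd E P (popp P) = Infinity) //.
  by case: {+}P => //= x y; rewrite eqxx opprK eqxx.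
case: (pselect (R = popp Q)) => [eR|nQR].
  rewrite (paddC (padd_on_curve cP cQ) cR) {2}eR.
  rewrite (paddC cP cQ) paddNK // eR (_ : padd E Q (popp Q) = Infinity).
    by case: {+}P.
  by case: {+}Q => //= x y; rewrite eqxx opprK eqxx.
case: P cP nPQ => [//|x1 y1] cP nPQ; case: Q cQ nPQ nQR => [//|x2 y2] cQ nPQ nQR.
case: R cR nQR => [|x3 y3] cR nQR; first by case: padd.
have [l sl] := line_slope_exists cP cQ nPQ.
have [m sm] := line_slope_exists cQ cR nQR.
case: (eqVneq l m) => [elm|nlm].
  subst m; case: sl sm => [s1 s2] [s3 s4].
  have e1 : y1 = y2 + l * (x1 - x2).
    by rewrite -[LHS](subKr y2) s1; ring.
  have e3 : y3 = y2 + l * (x3 - x2) by rewrite -s3; ring.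
  have : (x1 - x3) * (l ^+ 2 - x1 - x2 - x3) = 0.
    have : l * (y1 + y2) - (x1 ^+ 2 + x1 * x2 + x2 ^+ 2) =
           l * (y2 + y3) - (x2 ^+ 2 + x2 * x3 + x3 ^+ 2) by rewrite s2 s4; ring.
    by rewrite e1 e3 => h; lra.
  move/eqP; rewrite mulf_eq0 subr_eq0 => /orP[/eqP ex|/eqP h].
    have ey : y1 = y3 by rewrite e1 e3 ex.
    move: cR; rewrite -ex -ey => cR.
    by rewrite (paddC cP (padd_on_curve cQ cR)) (paddC cQ cP).
  rewrite (padd_line_slope ell cP cQ (conj s1 s2)).
  rewrite (padd_line_slope ell cQ cR (conj s3 s4)) /=.
  have -> : l ^+ 2 - x1 - x2 = x3 by apply/eqP; rewrite -subr_eq0 h.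
  have -> : l ^+ 2 - x2 - x3 = x1.
    by apply/eqP; rewrite -subr_eq0 -h; apply/eqP; ring.
  by rewrite !eqxx e1 e3 !ifT //; apply/eqP; ring.
have c12 := padd_on_curve cP cQ; have c23 := padd_on_curve cQ cR.
move: c12 c23; rewrite (padd_line_slope ell cP cQ sl).
rewrite (padd_line_slope ell cQ cR sm) => c12 c23.
rewrite (padd_line_slope ell c12 cR (line_slope_add nlm sl sm)).
have nml : m != l by rewrite eq_sym.
have := line_slope_add nml (line_slope_sym sm) (line_slope_sym sl); cbv zeta.
rewrite (_ : m ^+ 2 - x3 - x2 = m ^+ 2 - x2 - x3); last by ring.
have [s3 _] := sm; rewrite (_ : m * _ - y3 = m * (x2 - (m ^+ 2 - x2 - x3)) - y2).
  move=> /line_slope_sym sr; rewrite (padd_line_slope ell cP c23 sr).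
  have dl : l - m != 0 by rewrite subr_eq0.
  have dm : m - l != 0 by rewrite subr_eq0.
  have [s1 _] := sl.
  have -> : y1 = y2 - l * (x2 - x1) by rewrite -s1; ring.
  rewrite (line_slope_common_ordinate nlm sl sm).
  by rewrite /third_point; congr Affine; field; rewrite dl dm.
have -> : y3 = y2 + m * (x3 - x2) by rewrite -s3; ring.
by ring.
Qed.

Lemma no_two_torsion E P :
    (forall x, x ^+ 3 + coef_a E * x + coef_b E != 0) ->
  on_curve E P -> padd E P P = Infinity -> P = Infinity.
Proof.
move=> noroot; case: P => [//|x y] /eqP e /=; rewrite eqxx.
case: eqP => // yN _; have y0 : y = 0 by lra.
by case/eqP: (noroot x); rewrite -e y0 expr0n.
Qed.

(** The additive structure needs a proof that the curve is smooth, which the type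
    of the points does not mention. *)
Definition mordell_weil E (ell : elliptic E) := rational_points E.

HB.instance Definition _ E (ell : elliptic E) := gen_eqMixin (mordell_weil ell).
HB.instance Definition _ E (ell : elliptic E) :=
  gen_choiceMixin (mordell_weil ell).

Definition eopp E (P : rational_points E) : rational_points E :=
  exist (fun p => on_curve E p) _ (popp_on_curve (proj2_sig P)).

Lemma eaddA E : elliptic E -> associative (@eadd E).
Proof. by move=> ell P Q R; apply: val_inj; apply: paddA; rewrite ?(valP _). Qed.

Lemma eaddC E : commutative (@eadd E).
Proof. by move=> P Q; apply: val_inj; apply: paddC; apply: valP. Qed.

Lemma eadd0 E : left_id (@ezero E) (@eadd E).
Proof. by move=> P; apply: val_inj. Qed.

Lemma eaddN E : left_inverse (@ezero E) (@eopp E) (@eadd E).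
Proof. by move=> [[|x y] cP]; apply: val_inj; rewrite /= ?eqxx. Qed.

HB.instance Definition _ E (ell : elliptic E) :=
  GRing.isZmodule.Build (mordell_weil ell)
    (eaddA ell) (@eaddC E) (@eadd0 E) (@eaddN E).

(** * Independence of points and the rank *)

(** Infinite descent: in a relation [\sum_i u_i P_i = 0] write [u = 2 q + b] with
    [b] a vector of bits. The points with bit [1] add up to a double, so [b = 0];
    as there is no point of order two, [q] is again a relation, and it is
    smaller. *)
Lemma independent_of_mod2 (G : zmodType) n (P : 'I_n -> G) :
    (forall x : G, x *+ 2 = 0 -> x = 0) ->
    (forall (b : 'I_n -> bool) (x : G), \sum_(i | b i) P i = x *+ 2 ->
       forall i, b i = false) ->
  forall u : 'rV[int]_n, \sum_i P i *~ u 0 i = 0 -> u = 0.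
Proof.
move=> tor2 mod2 u; have [N le_uN] := ubnP (\sum_i `|u 0%R i|%N)%N.
elim: N u le_uN => // N IHN u le_uN sum0.
pose q : 'rV[int]_n := \row_i (u 0%R i %/ 2)%Z.
pose b i := (u 0%R i %% 2)%Z != 0.
have uE i : u 0 i = q 0 i * 2 + (b i)%:Z.
  rewrite mxE /b {1}(divz_eq (u 0 i) 2); congr (_ + _).
  have := @modz_ge0 (u 0 i) 2 isT; have := @ltz_pmod (u 0 i) 2 isT; lia.
have sumE : \sum_i P i *~ u 0 i =
            (\sum_i P i *~ q 0 i) *+ 2 + \sum_(i | b i) P i.
  rewrite -sumrMnl [X in _ + X]big_mkcond -big_split /=; apply: eq_bigr => i _.
  by rewrite uE mulrzDr mulrzA; case: (b i).
have b0 : forall i, b i = false.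
  apply: (mod2 b (- \sum_i P i *~ q 0 i)).
  by apply/eqP; rewrite mulNrn -addr_eq0 addrC -sumE sum0.
have q0 : \sum_i P i *~ q 0 i = 0.
  by apply: tor2; move: sumE; rewrite sum0 [X in _ + X]big_pred0 // addr0.
have u2q i : u 0 i = q 0 i * 2 by rewrite uE b0 /= addr0.
suff q_0 : q = 0 by apply/rowP => i; rewrite u2q q_0 !mxE.
have [u0|nu0] := eqVneq (\sum_i `|u 0%R i|%N)%N 0%N.
  apply/rowP => i; have := u2q i; rewrite !mxE.
  have : (`|u 0%R i| <= \sum_j `|u 0%R j|)%N by rewrite (bigD1 i) //= leq_addr.
  by rewrite u0; lia.
apply: IHN q0.
have : (\sum_i `|u 0%R i| = (\sum_i `|q 0%R i|) * 2)%N.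
  by rewrite big_distrl /=; apply: eq_bigr => i _; rewrite u2q; lia.
lia.
Qed.

(** An integer matrix with more rows than columns kills a nonzero integer row:
    the last row of its Smith normal form is zero. *)
Lemma additive_injection_leq n r (h : 'rV[int]_n -> 'rV[int]_r) :
  {morph h : u v / u + v} -> (forall u, h u = 0 -> u = 0) -> (n <= r)%N.
Proof.
move=> hD h_ker; rewrite leqNgt; apply/negP => lt_rn.
have h0 : h 0 = 0 by apply: (addrI (h 0)); rewrite -hD !addr0.
have hN u : h (- u) = - h u.
  by apply/eqP; rewrite -addr_eq0 -hD addNr h0.
have hMn u k : h (u *+ k) = h u *+ k.
  by elim: k => [|k IH]; rewrite ?mulr0n // !mulrS hD IH.
have hZ (a : int) u : h (a *: u) = a *: h u.
  rewrite -[a]intz !scaler_int; case: a => k; first exact: hMn.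
  by rewrite NegzE !mulrNz hN hMn.
pose M : 'M[int]_(n, r) := \matrix_(i, j) h (delta_mx 0 i) 0 j.
have hM u : h u = u *m M.
  rewrite {1}[u]row_sum_delta (big_morph h hD h0); apply/rowP => j.
  by rewrite summxE !mxE; apply: eq_bigr => i _; rewrite hZ !mxE.
have [L uL [R uR [d _ eM]]] := int_Smith_normal_form M.
have n_gt0 : (0 < n)%N by apply: leq_ltn_trans lt_rn.
have ltk : (n.-1 < n)%N by rewrite prednK.
pose e : 'rV[int]_n := delta_mx 0 (Ordinal ltk).
have e0 : e = 0.
  rewrite -(mulmxKV uL e) (h_ker (e *m invmx L)) ?mul0mx // hM eM.
  rewrite !mulmxA mulmxKV // -rowE [X in X *m R](_ : _ = 0) ?mul0mx //.
  apply/rowP => j; rewrite !mxE eqn_leq [(_ <= j)%N]leqNgt.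
  by rewrite (leq_trans (ltn_ord j)) ?mulr0n // -ltnS prednK.
by have /rowP/(_ (Ordinal ltk)) := e0; rewrite !mxE !eqxx.
Qed.

(** The projection of [E(Q)] to [Z^r] has torsion kernel, so it is injective on a
    copy of [Z^n]. *)
Lemma embeds_Zn_rank_ge E n : elliptic E -> embeds_Zn E n -> rank_ge E n.
Proof.
move=> ell emb; split=> // r [f [[fT f_inj _] fD]].
have [g [g_inj gD]] := emb.
pose W : zmodType := mordell_weil ell.
pose G : 'rV[int]_n -> W := g.
pose F : W -> 'rV[int]_r * W := f.
have FD P Q : F (P + Q) = ((F P).1 + (F Q).1, (F P).2 + (F Q).2) by apply: fD.
have GD u v : G (u + v) = G u + G v by apply: gD.
have F0 : F 0 = 0.
  have idem (V : zmodType) (x : V) : x = x + x -> x = 0.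
    by move=> /esym/(canRL (addrK x)) ->; rewrite subrr.
  have := FD 0 0; rewrite addr0; case: (F 0) => a T /= [].
  by move=> /idem -> /idem ->.
have G0 : G 0 = 0 by apply: (addrI (G 0)); rewrite -GD !addr0.
have FMn P k : F (P *+ k) = ((F P).1 *+ k, (F P).2 *+ k).
  by elim: k => [|k IH]; rewrite ?mulr0n ?F0 // !mulrS FD IH.
have GMn u k : G (u *+ k) = G u *+ k.
  by elim: k => [|k IH]; rewrite ?mulr0n ?G0 // !mulrS GD IH.
apply: (@additive_injection_leq _ _ (fun u => (F (G u)).1)) => [u v|u hu].
  by rewrite GD FD.
have [_ [k k_gt0 kT]] := fT (G u) I.
have {}kT : (F (G u)).2 *+ k = 0 by rewrite -[LHS]addr0 -iter_addr.
have Guk : G u *+ k = 0.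
  apply: f_inj; rewrite ?in_setT //.
  by rewrite -/F -[LHS]/(F _) -[RHS]/(F _) FMn hu kT mul0rn F0.
have /rowP uk0 : u *+ k = 0 by apply: g_inj; rewrite -[LHS]/(G _) GMn Guk -G0.
apply/rowP => i; have := uk0 i; rewrite mulmxnE !mxE => /eqP.
by rewrite mulrn_eq0 eqn0Ngt k_gt0 => /eqP.
Qed.

(** * Reduction of rational numbers *)

(** Reduction modulo a prime is a partial map on the rationals, which this
    relation presents as its graph. The field [k] stands for the residue field. *)
Definition reduces (k : fieldType) (q : rat) (r : k) : Prop :=
  exists n d : int, [/\ d%:~R != 0 :> k, q = n%:~R / d%:~R & r = n%:~R / d%:~R].

Lemma ratz_neq0 (k : fieldType) (d : int) :
  d%:~R != 0 :> k -> d%:~R != 0 :> rat.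
Proof. by apply: contra_neq => /eqP; rewrite intr_eq0 => /eqP ->. Qed.

Lemma reduces_int (k : fieldType) (n : int) : reduces n%:~R (n%:~R : k).
Proof. by exists n, 1; rewrite !divr1 oner_neq0. Qed.

Lemma reduces_nat (k : fieldType) (n : nat) : reduces n%:R (n%:R : k).
Proof. exact: (reduces_int k n). Qed.

Lemma reducesN (k : fieldType) q (r : k) : reduces q r -> reduces (- q) (- r).
Proof.
by case=> n [d [d0 -> ->]]; exists (- n), d; rewrite !mulrNz !mulNr.
Qed.

Lemma reducesD (k : fieldType) q1 (r1 : k) q2 r2 :
  reduces q1 r1 -> reduces q2 r2 -> reduces (q1 + q2) (r1 + r2).
Proof.
case=> n1 [d1 [d1k -> ->]] [n2 [d2 [d2k -> ->]]].
exists (n1 * d2 + n2 * d1), (d1 * d2).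
rewrite !intrD !intrM mulf_neq0 //; split=> //.
  by field; rewrite !(ratz_neq0 d1k, ratz_neq0 d2k).
by field; rewrite d1k d2k.
Qed.

Lemma reducesM (k : fieldType) q1 (r1 : k) q2 r2 :
  reduces q1 r1 -> reduces q2 r2 -> reduces (q1 * q2) (r1 * r2).
Proof.
case=> n1 [d1 [d1k -> ->]] [n2 [d2 [d2k -> ->]]].
exists (n1 * n2), (d1 * d2).
by rewrite !intrM mulf_neq0 // !mulf_div.
Qed.

Lemma reducesX (k : fieldType) q (r : k) n :
  reduces q r -> reduces (q ^+ n) (r ^+ n).
Proof.
move=> qr; elim: n => [|n IH]; first exact: (reduces_nat k 1).
by rewrite !exprS; apply: reducesM.
Qed.

Lemma reducesV (k : fieldType) q (r : k) :
  reduces q r -> r != 0 -> reduces q^-1 r^-1.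
Proof.
case=> n [d [dk -> ->]]; rewrite mulf_eq0 invr_eq0 negb_or => /andP[nk _].
by exists d, n; rewrite !invf_div.
Qed.

Lemma reduces_inj (k : fieldType) q (r1 r2 : k) :
  reduces q r1 -> reduces q r2 -> r1 = r2.
Proof.
move=> q1 q2; apply/eqP; rewrite -subr_eq0.
have [n [d [dk]]] := reducesD q1 (reducesN q2).
rewrite subrr => /esym/eqP; rewrite mulf_eq0 invr_eq0.
by rewrite (negbTE (ratz_neq0 dk)) orbF intr_eq0 => /eqP -> ->; rewrite mul0r.
Qed.

Lemma reduces_neq0 (k : fieldType) q (r : k) : reduces q r -> r != 0 -> q != 0.
Proof.
move=> qr; apply: contra_neq => q0; rewrite q0 in qr.
exact: reduces_inj qr (reduces_nat k 0).
Qed.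

(** The local ring of rationals with a reduction is a valuation ring: if the
    denominator in lowest terms vanishes in [k], the numerator does not. *)
Lemma reduces_or_pole (k : fieldType) q :
  (exists r : k, reduces q r) \/ q != 0 /\ reduces q^-1 (0 : k).
Proof.
have [dk|dk] := eqVneq ((denq q)%:~R : k) 0; last first.
  by left; exists ((numq q)%:~R / (denq q)%:~R), (numq q), (denq q);
    rewrite divq_num_den.
have nk : (numq q)%:~R != 0 :> k.
  have [u [v uv]] := Bezoutz (numq q) (denq q).
  have := coprime_num_den q; rewrite /coprime => /eqP cop.
  have := congr1 (fun z : int => z%:~R : k) uv.
  rewrite intrD !intrM dk mulr0 addr0 /gcdz cop => h.
  by apply/eqP => nk; move/eqP: h; rewrite nk mulr0 eq_sym oner_eq0.
right; split; first by apply: contraNneq nk => ->; rewrite mulr0z.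
exists (denq q), (numq q); rewrite nk dk mul0r; split=> //.
by rewrite -[q in LHS]divq_num_den invf_div.
Qed.

Lemma reducesB (k : fieldType) q1 (r1 : k) q2 r2 :
  reduces q1 r1 -> reduces q2 r2 -> reduces (q1 - q2) (r1 - r2).
Proof. by move=> h1 h2; apply/reducesD/reducesN. Qed.

Lemma reduces_div (k : fieldType) q1 (r1 : k) q2 r2 :
  reduces q1 r1 -> reduces q2 r2 -> r2 != 0 -> reduces (q1 / q2) (r1 / r2).
Proof. by move=> h1 h2 r0; apply/reducesM/reducesV. Qed.

(** The point [2 (x, y)] has the abscissa [X] for which [4 X y^2] equals
    [(x^2 - A)^2 - 8 B x]. If [x] reduces to [k], so does [y], because [y^2] does,
    and the reduced equation is excluded. If [x] has a pole, dividing by [x^4]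
    turns the equation into [0 = 1] in [k], as the left side has degree three
    only. *)
Lemma not_double_of_reduction (k : fieldType) E (al be xi : k) X Y :
    reduces (coef_a E) al -> reduces (coef_b E) be -> reduces X xi ->
    (forall x y : k, y ^+ 2 = x ^+ 3 + al * x + be ->
       4 * xi * y ^+ 2 != (x ^+ 2 - al) ^+ 2 - 8 * be * x) ->
  forall Q, on_curve E Q -> padd E Q Q <> Affine X Y.
Proof.
move=> hA hB hX nodbl [|x y] //= /eqP e; rewrite eqxx.
case: eqP => // ny; have y0 : y != 0.
  by apply/eqP => y0; apply: ny; rewrite y0 oppr0.
case=> eX _.
have {eX} dbl : 4 * X * y ^+ 2 = (x ^+ 2 - coef_a E) ^+ 2 - 8 * coef_b E * x.
  have -> : coef_b E = y ^+ 2 - x ^+ 3 - coef_a E * x by rewrite e; ring.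
  by rewrite -eX; field.
have [[r xr]|[x0 w0]] := reduces_or_pole k x.
  have fr := reducesD (reducesD (reducesX 3 xr) (reducesM hA xr)) hB.
  have [[z yz]|[_ v0]] := reduces_or_pole k y.
    have := reduces_inj (reducesX 2 yz); rewrite e => /(_ _ fr) /nodbl /eqP.
    apply; apply: (@reduces_inj k (4 * X * y ^+ 2)).
      by apply/reducesM/reducesX/yz/reducesM/hX/reduces_nat.
    rewrite dbl; apply: reducesB.
      by apply/reducesX/reducesB/hA/reducesX/xr.
    by apply/reducesM/xr/reducesM/hB/reduces_nat.
  have := reducesM (reducesX 2 v0) fr; rewrite -e -exprMn mulVf // expr1n.
  move=> /(reduces_inj (reduces_nat k 1)) /eqP.
  by rewrite expr0n mul0r oner_eq0.
have := dbl; rewrite e; set w := x^-1 in w0 => /(congr1 ( *%R (w ^+ 4))).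
have -> : w ^+ 4 * (4 * X * (x ^+ 3 + coef_a E * x + coef_b E)) =
          4 * X * (w + coef_a E * w ^+ 3 + coef_b E * w ^+ 4).
  by rewrite /w; field.
have -> : w ^+ 4 * ((x ^+ 2 - coef_a E) ^+ 2 - 8 * coef_b E * x) =
          (1 - coef_a E * w ^+ 2) ^+ 2 - 8 * coef_b E * w ^+ 3.
  by rewrite /w; field.
move=> eqw.
have hl : reduces (4 * X * (w + coef_a E * w ^+ 3 + coef_b E * w ^+ 4))
                  (4 * xi * (0 + al * 0 ^+ 3 + be * 0 ^+ 4)).
  apply: reducesM; first by apply/reducesM/hX/reduces_nat.
  by apply/reducesD/reducesM/reducesX/w0/hB/reducesD/reducesM/reducesX/w0/hA.
have hr : reduces ((1 - coef_a E * w ^+ 2) ^+ 2 - 8 * coef_b E * w ^+ 3)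
                  ((1 - al * 0 ^+ 2) ^+ 2 - 8 * be * 0 ^+ 3).
  apply: reducesB.
    by apply/reducesX/reducesB/reducesM/reducesX/w0/hA/(reduces_nat k 1).
  by apply/reducesM/reducesX/w0/reducesM/hB/reduces_nat.
rewrite eqw in hl; have /eqP := reduces_inj hl hr.
by rewrite !expr0n /= !mulr0 !addr0 mulr0 !subr0 expr1n eq_sym oner_eq0.
Qed.

Lemma no_root_of_reduction (k : fieldType) (A B : rat) (al be : k) :
    reduces A al -> reduces B be ->
    (forall x : k, x ^+ 3 + al * x + be != 0) ->
  forall x, x ^+ 3 + A * x + B != 0.
Proof.
move=> hA hB noroot x.
have [[r xr]|[x0 w0]] := reduces_or_pole k x.
  apply: reduces_neq0 (noroot r).
  by apply/reducesD/hB/reducesD/reducesM/xr/hA/reducesX.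
set w := x^-1 in w0.
have -> : x ^+ 3 + A * x + B = x ^+ 3 * (1 + A * w ^+ 2 + B * w ^+ 3).
  by rewrite /w; field.
rewrite mulf_neq0 ?expf_neq0 //.
have := oner_neq0 k; apply: reduces_neq0.
have -> : 1 = 1 + al * 0 ^+ 2 + be * 0 ^+ 3 by rewrite !expr0n !mulr0 !addr0.
apply/reducesD/reducesM/reducesX/w0/hB.
by apply/reducesD/reducesM/reducesX/w0/hA/(reduces_nat k 1).
Qed.

Lemma discriminant_neq0_of_reduction (k : fieldType) E (al be : k) :
    reduces (coef_a E) al -> reduces (coef_b E) be ->
    - 16 * (4 * al ^+ 3 + 27 * be ^+ 2) != 0 -> elliptic E.
Proof.
move=> ha hb; apply: reduces_neq0; have hn := reduces_nat k.
apply: reducesM; first by apply/reducesN/hn.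
by apply: reducesD; apply: reducesM (hn _) _; apply: reducesX.
Qed.

(** * Exhaustive tests over prime fields *)

(** An explicit list rather than the enumeration of the finite type, so that the
    exhaustive tests below evaluate by computation. *)
Definition Fp_elements p : seq 'F_p := [seq n%:R | n <- iota 0 p].

Lemma mem_Fp_elements p (x : 'F_p) : prime p -> x \in Fp_elements p.
Proof.
move=> p_pr; apply/mapP; exists (x : nat); last by rewrite natr_Zp.
by rewrite mem_iota add0n -[p in X in (_ < X)%N](Fp_cast p_pr) ltn_ord.
Qed.

(** The test uses the duplication formula with its denominator [4 y^2] cleared, so
    that points of order two need no exception; on a smooth curve they never
    satisfy it. *)
Definition no_doubleb p (al be xi : 'F_p) : bool :=
  all (fun x => all (fun y =>
      (y ^+ 2 == x ^+ 3 + al * x + be) ==>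
      (4 * xi * y ^+ 2 != (x ^+ 2 - al) ^+ 2 - 8 * be * x))
    (Fp_elements p)) (Fp_elements p).

Lemma no_doublebP p (al be xi : 'F_p) : prime p -> no_doubleb al be xi ->
  forall x y : 'F_p, y ^+ 2 = x ^+ 3 + al * x + be ->
    4 * xi * y ^+ 2 != (x ^+ 2 - al) ^+ 2 - 8 * be * x.
Proof.
move=> p_pr /allP nodbl x y /eqP e; have mem z := mem_Fp_elements z p_pr.
exact: implyP (allP (nodbl x (mem x)) y (mem y)) e.
Qed.

Definition no_rootb p (al be : 'F_p) : bool :=
  all (fun x => x ^+ 3 + al * x + be != 0) (Fp_elements p).

Lemma no_rootbP p (al be : 'F_p) : prime p -> no_rootb al be ->
  forall x, x ^+ 3 + al * x + be != 0.
Proof.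
by move=> p_pr /allP noroot x; apply: noroot; apply: mem_Fp_elements.
Qed.

(** * Three points on the curve *)

Lemma curve_E_point0 t : on_curve (curve_E t) (Affine 0 (t ^+ 2 - 1)).
Proof. by apply/eqP => /=; ring. Qed.

Lemma curve_E_point1 t : on_curve (curve_E t) (Affine (2 * t) (t ^+ 2 - 1)).
Proof. by apply/eqP => /=; ring. Qed.

(** With the Pythagorean triple [a = 2 t], [b = t^2 - 1], [c = t^2 + 1] the curve is
    [y^2 = x^3 - a^2 x + b^2]. At [x = c] the right side is
    [c (c^2 - a^2) + b^2 = b^2 (c + 1)], a square as soon as [t^2 + 2] is one. *)
Lemma curve_E_point2 t s : s ^+ 2 = t ^+ 2 + 2 ->
  on_curve (curve_E t) (Affine (t ^+ 2 + 1) ((t ^+ 2 - 1) * s)).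
Proof. by move=> s2; apply/eqP => /=; rewrite exprMn s2; ring. Qed.

Definition three_points t s (s2 : s ^+ 2 = t ^+ 2 + 2) (i : 'I_3) :
    rational_points (curve_E t) :=
  match val i with
  | 0 => exist (fun p => on_curve (curve_E t) p) _ (curve_E_point0 t)
  | 1 => exist (fun p => on_curve (curve_E t) p) _ (curve_E_point1 t)
  | _ => exist (fun p => on_curve (curve_E t) p) _ (curve_E_point2 s2)
  end%N.

Lemma exists_ord3 (b : 'I_3 -> bool) i : b i -> [|| b 0, b 1 | b 2].
Proof.
by case: i => [[|[|[|//]]] lti] bi; apply/or3P;
  [constructor 1|constructor 2|constructor 3]; move: bi;
  congr (is_true (b _)); apply: val_inj.
Qed.

(** The abscissa of the sum of the points that the bits select, over any field, so
    that it can be evaluated both over the rationals and over a residue field.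
    The value for the empty sum, which has no abscissa, is arbitrary. *)
Definition subset_sum_abscissa (k : fieldType) (t s : k) (b1 b2 b3 : bool) : k :=
  match b1, b2, b3 with
  | false, true, false => 2 * t
  | true, true, false => - (2 * t)
  | false, false, true => t ^+ 2 + 1
  | true, false, true =>
      ((t ^+ 2 - 1) * (s - 1) / (t ^+ 2 + 1)) ^+ 2 - (t ^+ 2 + 1)
  | false, true, true =>
      ((t + 1) * (s - 1) / (t - 1)) ^+ 2 - 2 * t - (t ^+ 2 + 1)
  | true, true, true =>
      ((t - 1) * (s + 1) / (t + 1)) ^+ 2 + 2 * t - (t ^+ 2 + 1)
  | _, _, false => 0
  end.

Lemma subset_sum_abscissaP t s (s2 : s ^+ 2 = t ^+ 2 + 2)
    (ell : elliptic (curve_E t)) (b : 'I_3 -> bool) :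
    t != 0 -> t - 1 != 0 -> t + 1 != 0 -> [|| b 0, b 1 | b 2] ->
  exists y, sval (\sum_(i | b i) (three_points s2 i : mordell_weil ell)) =
    Affine (subset_sum_abscissa t s (b 0) (b 1) (b 2)) y.
Proof.
move=> t0 tm1 tp1 bN0.
have c0 : t ^+ 2 + 1 != 0 by rewrite gt_eqF // ltr_wpDl ?sqr_ge0.
pose E := curve_E t; pose A1 := Affine 0 (t ^+ 2 - 1).
pose A2 := Affine (2 * t) (t ^+ 2 - 1).
pose A3 := Affine (t ^+ 2 + 1) ((t ^+ 2 - 1) * s).
pose opt (c : bool) A := if c then A else Infinity.
have -> : sval (\sum_(i | b i) (three_points s2 i : mordell_weil ell)) =
          padd E (opt (b 0) A1) (padd E (opt (b 1) A2) (opt (b 2) A3)).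
  rewrite big_mkcond !big_ord_recl big_ord0.
  rewrite (_ : lift ord0 ord0 = 1); last exact: val_inj.
  rewrite (_ : lift ord0 (lift ord0 ord0) = 2); last exact: val_inj.
  by case: (b 0) (b 1) (b 2) => [] [] [].
have chord x1 y1 x2 y2 : x2 - x1 != 0 -> padd E (Affine x1 y1) (Affine x2 y2) =
    third_point ((y2 - y1) / (x2 - x1)) x1 y1 x2.
  by rewrite /= subr_eq0 eq_sym => /negbTE ->.
have E12 : padd E A1 A2 = Affine (- (2 * t)) (- (t ^+ 2 - 1)).
  rewrite chord; first by congr Affine; field.
  by rewrite subr0 mulf_neq0.
rewrite /opt /subset_sum_abscissa.
move: bN0; case: (b 0) (b 1) (b 2) => [] [] [] // _.
- have d : t ^+ 2 + 1 - - (2 * t) != 0.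
    by rewrite (_ : _ - _ = (t + 1) ^+ 2) ?expf_neq0 //; ring.
  rewrite paddA ?curve_E_point0 ?curve_E_point1 ?(curve_E_point2 s2) //.
  rewrite E12 chord //.
  by eexists; congr Affine; field; rewrite tp1.
- by exists (- (t ^+ 2 - 1)); rewrite -E12.
- rewrite chord ?subr0 //.
  by eexists; congr Affine; field.
- by exists (t ^+ 2 - 1).
- have d : t ^+ 2 + 1 - 2 * t != 0.
    by rewrite (_ : _ - _ = (t - 1) ^+ 2) ?expf_neq0 //; ring.
  rewrite chord //.
  by eexists; congr Affine; field; rewrite tm1.
- by exists (t ^+ 2 - 1).
by exists ((t ^+ 2 - 1) * s).
Qed.

(** The lines through a point at infinity parametrize the conic
    [s^2 = t^2 + 2] by [m = s - t]. *)
Definition param_t (k : fieldType) (m : k) : k := (2 - m ^+ 2) / (2 * m).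
Definition param_s (k : fieldType) (m : k) : k := (2 + m ^+ 2) / (2 * m).

Lemma param_conic (m : rat) : m != 0 -> param_s m ^+ 2 = param_t m ^+ 2 + 2.
Proof. by move=> m0; rewrite /param_s /param_t; field. Qed.

Lemma reduces_param_t (k : fieldType) m (mu : k) :
  reduces m mu -> 2 * mu != 0 -> reduces (param_t m) (param_t mu).
Proof.
move=> hm mu0; apply: (reduces_div _ _ mu0).
  by apply/reducesB/reducesX/hm/reduces_nat.
by apply/reducesM/hm/reduces_nat.
Qed.

Lemma reduces_param_s (k : fieldType) m (mu : k) :
  reduces m mu -> 2 * mu != 0 -> reduces (param_s m) (param_s mu).
Proof.
move=> hm mu0; apply: (reduces_div _ _ mu0).
  by apply/reducesD/reducesX/hm/reduces_nat.
by apply/reducesM/hm/reduces_nat.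
Qed.

Lemma reduces_coef_a (k : fieldType) t (ta : k) :
  reduces t ta -> reduces (coef_a (curve_E t)) (- (2 * ta) ^+ 2).
Proof. by move=> ht; apply/reducesN/reducesX/reducesM/ht/reduces_nat. Qed.

Lemma reduces_coef_b (k : fieldType) t (ta : k) :
  reduces t ta -> reduces (coef_b (curve_E t)) ((ta ^+ 2 - 1) ^+ 2).
Proof.
by move=> ht; apply/reducesX/reducesB/(reduces_nat k 1)/reducesX.
Qed.

Lemma reduces_subset_sum_abscissa (k : fieldType) t s (ta sa : k) b1 b2 b3 :
    reduces t ta -> reduces s sa ->
    [&& ta - 1 != 0, ta + 1 != 0 & ta ^+ 2 + 1 != 0] ->
  reduces (subset_sum_abscissa t s b1 b2 b3)
    (subset_sum_abscissa ta sa b1 b2 b3).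
Proof.
move=> ht hs /and3P[tm1 tp1 c0].
have h1 := reduces_nat k 1; have h2 := reduces_nat k 2.
have hb : reduces (2 * t) (2 * ta) by apply: reducesM.
have hc : reduces (t ^+ 2 + 1) (ta ^+ 2 + 1) by apply/reducesD/h1/reducesX.
have htB := reducesB ht h1; have htD := reducesD ht h1.
have hsB := reducesB hs h1; have hsD := reducesD hs h1.
rewrite /subset_sum_abscissa; case: b1 b2 b3 => [] [] [] //.
- apply: reducesB hc; apply: reducesD hb; apply: reducesX.
  by apply: reduces_div tp1; first apply: reducesM.
- exact: reducesN.
- apply: reducesB (hc); apply: reducesX; apply: reduces_div hc c0.
  by apply: reducesM => //; apply/reducesB/h1/reducesX.
- exact: (reduces_nat k 0).
- apply: reducesB hc; apply: reducesB hb; apply: reducesX.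
  by apply: reduces_div tm1; first apply: reducesM.
exact: (reduces_nat k 0).
Qed.

Lemma not_double_subset_sum p (m : rat) (mu : 'F_p) b1 b2 b3 :
    prime p -> reduces m mu ->
    let ta := param_t mu in let sa := param_s mu in
    [&& 2 * mu != 0, ta - 1 != 0, ta + 1 != 0 & ta ^+ 2 + 1 != 0] ->
    no_doubleb (- (2 * ta) ^+ 2) ((ta ^+ 2 - 1) ^+ 2)
      (subset_sum_abscissa ta sa b1 b2 b3) ->
  forall Q y, on_curve (curve_E (param_t m)) Q ->
    padd (curve_E (param_t m)) Q Q <>
    Affine (subset_sum_abscissa (param_t m) (param_s m) b1 b2 b3) y.
Proof.
move=> p_pr hm ta sa /andP[mu0 nz] nodbl Q y cQ.
have ht := reduces_param_t hm mu0; have hs := reduces_param_s hm mu0.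
apply: (not_double_of_reduction (reduces_coef_a ht) (reduces_coef_b ht)) cQ.
  exact: (reduces_subset_sum_abscissa b1 b2 b3 ht hs nz).
exact: (no_doublebP p_pr nodbl).
Qed.

(** * Infinitely many parameters *)

(** As [E(F_p) / 2 E(F_p)] has at most four elements, no single prime detects all
    seven sums. Modulo [17] only the second point is a double. *)
Lemma no_doubleb_17 b1 b2 b3 (ta := param_t (7 : 'F_17)) :
  [|| b1, b2 | b3] && ~~ [&& ~~ b1, b2 & ~~ b3] ==>
  no_doubleb (- (2 * ta) ^+ 2) ((ta ^+ 2 - 1) ^+ 2)
    (subset_sum_abscissa ta (param_s 7) b1 b2 b3).
Proof. by move: b1 b2 b3 => [] [] []; vm_compute. Qed.

Lemma no_doubleb_7 (ta := param_t (1 : 'F_7)) :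
  no_doubleb (- (2 * ta) ^+ 2) ((ta ^+ 2 - 1) ^+ 2)
    (subset_sum_abscissa ta (param_s 1) false true false).
Proof. by vm_compute. Qed.

(** Modulo [11] the cubic has no root, so there is no rational point of order two;
    modulo [17] and [7] none of the seven sums of the three points is a
    double. *)
Lemma param_t_rank_ge3 (m : rat) :
    reduces m (1 : 'F_7) -> reduces m (1 : 'F_11) -> reduces m (7 : 'F_17) ->
  elliptic (curve_E (param_t m)) /\ rank_ge (curve_E (param_t m)) 3.
Proof.
move=> h7 h11 h17.
have m0 : m != 0 by apply: reduces_neq0 h7 _.
have t7 := reduces_param_t h7 isT; have t11 := reduces_param_t h11 isT.
have ell : elliptic (curve_E (param_t m)).
  apply: (discriminant_neq0_of_reduction (reduces_coef_a t7)
            (reduces_coef_b t7)).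
  by vm_compute.
split=> //; apply: embeds_Zn_rank_ge => //.
have conic := param_conic m0.
pose P i : mordell_weil ell := three_points conic i.
exists (fun u : 'rV[int]_3 => \sum_i P i *~ u 0 i); split; last first.
  move=> u v; rewrite -[RHS]/(_ + _ : mordell_weil ell) -big_split /=.
  by apply: eq_bigr => i _; rewrite mxE mulrzDr.
move=> u v uv; apply/eqP; rewrite -subr_eq0; apply/eqP.
apply: (@independent_of_mod2 _ _ P).
- move=> x x2; apply: val_inj.
  have : padd (curve_E (param_t m)) (sval x) (sval x) = Infinity.
    by rewrite -[LHS]/(sval (x + x)) -mulr2n x2.
  apply: no_two_torsion (valP x).
  apply: (no_root_of_reduction (reduces_coef_a t11) (reduces_coef_b t11)).
  by apply: no_rootbP => //; vm_compute.
- move=> b x bx i; apply/negbTE/negP => bi.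
  have t0 : param_t m != 0 by apply: reduces_neq0 t7 _; vm_compute.
  have tm1 : param_t m - 1 != 0.
    by apply: reduces_neq0 (reducesB t7 (reduces_nat _ 1)) _; vm_compute.
  have tp1 : param_t m + 1 != 0.
    by apply: reduces_neq0 (reducesD t7 (reduces_nat _ 1)) _; vm_compute.
  have bN0 := exists_ord3 bi.
  have [y] := subset_sum_abscissaP conic ell t0 tm1 tp1 bN0.
  have -> : sval (\sum_(j | b j) (P j : mordell_weil ell)) =
            padd (curve_E (param_t m)) (sval x) (sval x) by rewrite bx.
  have cx := valP x.
  case eb : [&& ~~ b 0, b 1 & ~~ b 2].
    have /and3P[/negbTE-> -> /negbTE->] := eb.
    by apply: (not_double_subset_sum _ h7 _ no_doubleb_7 cx); last vm_compute.
  apply: (not_double_subset_sum _ h17 _ _ cx); [by []|by vm_compute|].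
  by apply: implyP (no_doubleb_17 _ _ _) _; rewrite bN0 eb.
- under eq_bigr => i _ do rewrite !mxE mulrzBr.
  by rewrite sumrB uv subrr.
Qed.

Lemma param_t_inj (m n : rat) :
  0 < m -> 0 < n -> param_t m = param_t n -> m = n.
Proof.
move=> m_gt0 n_gt0 eq_t.
have m0 : m != 0 by rewrite gt_eqF.
have n0 : n != 0 by rewrite gt_eqF.
have : (m - n) * (2 + m * n) = 0.
  have -> : (m - n) * (2 + m * n) = 2 * m * n * (param_t n - param_t m).
    by rewrite /param_t; field; rewrite m0.
  by rewrite eq_t subrr mulr0.
move/eqP; rewrite mulf_eq0 subr_eq0 => /orP[/eqP //|].
by rewrite gt_eqF // addr_gt0 // mulr_gt0.
Qed.

Local Open Scope classical_set_scope.

Theorem theorem4p1 :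
  infinite_set [set t : rat | elliptic (curve_E t) /\ rank_ge (curve_E t) 3].
Proof.
(* 1309 = 7 * 11 * 17, and 925 is congruent to 1, 1 and 7 modulo these primes. *)
pose m (n : nat) : rat := (925 + 1309 * n)%:R.
have red p (mu : 'F_p) n : (925%:R == mu) && (1309%:R == 0 :> 'F_p) ->
    reduces (m n) mu.
  case/andP=> /eqP <- /eqP p1309.
  have <- : (925 + 1309 * n)%:R = 925%:R :> 'F_p.
    by rewrite natrD natrM p1309 mul0r addr0.
  exact: reduces_nat.
pose f (n : nat) : rat := param_t (m n).
suff : infinite_set (range f).
  apply: sub_infinite_set.
  by move=> _ [n _ <-]; apply: param_t_rank_ge3; apply: red; vm_compute.
have m_gt0 n : 0 < m n by rewrite ltr0n addn_gt0.
have inj : {in [set: nat] &, injective f}.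
  move=> a b _ _ /(param_t_inj (m_gt0 a) (m_gt0 b)) /eqP.
  by rewrite eqr_nat eqn_add2l eqn_pmul2l // => /eqP.
by rewrite (eq_finite_set (inj_card_eq inj)); apply: infinite_nat.
Qed.
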